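(* Let $T$ be a tree with at least one edge and let $n$ be a positive integer such that $|V(T)|\ge n^2+(s(T)-2)(n-1)+1$. Then $T$ has $n$ pairwise vertex-disjoint subtrees, each with at least $n$ vertices.
   Context: All graphs are finite, simple and undirected. For a graph $G$, $s(G)$ denotes the maximum integer $t$ such that the star $S_t=K_{1,t}$ (with $t$ leaves) is a minor of $G$. *)

(* Defs.v *)
From mathcomp Require Import all_boot.

Set Implicit Arguments.
Unset Strict Implicit.
Unset Printing Implicit Defensive.

Record sgraph := SGraph {
  vertex :> finType;
  edge : rel vertex;
  edge_sym : symmetric edge;
  edge_irrefl : irreflexive edge
}.

Record subgraph (G : sgraph) := Subgraph {
  sub_vertices : {set G};
  sub_edge : rel G;
  sub_edge_sym : symmetric sub_edge;
  sub_edge_incl : forall x y, sub_edge x y ->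
    [/\ edge x y, x \in sub_vertices & y \in sub_vertices]
}.

Section SubgraphAsGraph.
Variables (G : sgraph) (H : subgraph G).

Let V := {x : G | x \in sub_vertices H}.
Let E : rel V := fun u v => sub_edge H (val u) (val v).

Fact subgraph_edge_sym : symmetric E.
Proof. by move=> u v; apply: sub_edge_sym. Qed.

Fact subgraph_edge_irrefl : irreflexive E.
Proof.
move=> u; apply/negP => /sub_edge_incl[].
by rewrite edge_irrefl.
Qed.

Definition sgraph_of_subgraph : sgraph :=
  SGraph subgraph_edge_sym subgraph_edge_irrefl.
End SubgraphAsGraph.

Coercion sgraph_of_subgraph : subgraph >-> sgraph.

Section Induced.
Variables (G : sgraph) (A : {set G}).

Let E : rel G := fun x y => [&& x \in A, y \in A & edge x y].

Fact induced_edge_sym : symmetric E.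
Proof. by move=> x y; rewrite /E edge_sym andbCA. Qed.

Fact induced_edge_incl x y : E x y -> [/\ edge x y, x \in A & y \in A].
Proof. by case/and3P. Qed.

Definition induced : subgraph G :=
  Subgraph induced_edge_sym induced_edge_incl.
End Induced.

(* The graph without vertices is not connected, hence not a tree. *)
Definition connected_graph (G : sgraph) : bool :=
  (0 < #|G|) && [forall x : G, forall y : G, connect (@edge G) x y].

(* [ucycle] also accepts an edge traversed back and forth (and the empty
   sequence), so genuine cycles are those of length at least 3. *)
Definition acyclic_graph (G : sgraph) : Prop :=
  forall c : seq G, ucycle (@edge G) c -> size c < 3.

Definition is_tree (G : sgraph) : Prop := connected_graph G /\ acyclic_graph G.

(* [B] assigns to the vertices of [H] the branch sets of an [H]-minor of [G];
   they are nonempty because [connected_graph] requires a vertex. *)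
Definition minor_model (H G : sgraph) (B : {ffun H -> {set G}}) : bool :=
  [&& [forall x : H, connected_graph (induced (B x))],
      [forall x : H, forall y : H, (x != y) ==> [disjoint B x & B y]]
    & [forall x : H, forall y : H, edge x y ==>
         [exists u in B x, exists v in B y, edge u v]]].

Definition minor (H G : sgraph) : bool :=
  [exists B : {ffun H -> {set G}}, minor_model B].

Section Star.
Variable t : nat.

(* The centre is [None], the leaves are the [Some i]. *)
Let E : rel (option 'I_t) := fun x y => isSome x (+) isSome y.

Fact star_edge_sym : symmetric E.
Proof. by move=> x y; rewrite /E addbC. Qed.

Fact star_edge_irrefl : irreflexive E.
Proof. by move=> x; rewrite /E addbb. Qed.

Definition star : sgraph := SGraph star_edge_sym star_edge_irrefl.
End Star.

(* The bound on [t] loses nothing, by [star_minor_ltn] below; when [G] has a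
   vertex, the maximum is attained by [star_number_minor]. *)
Definition star_number (G : sgraph) : nat :=
  \max_(t < #|G| | minor (star t) G) t.

Lemma minor_card (H G : sgraph) : minor H G -> #|H| <= #|G|.
Proof.
case/existsP=> B /and3P[/forallP Bconn /forallP Bdisj _].
have pickB x : exists u, u \in B x.
  have /andP[/card_gt0P[u _] _] := Bconn x.
  by exists (val u); exact: (valP u).
pose f x := xchoose (pickB x).
apply: (@leq_card H G f) => x y fxy.
apply/eqP; apply: contraT => nxy.
move/(_ x)/forallP/(_ y)/implyP/(_ nxy): Bdisj.
move/disjointFr/(_ (xchooseP (pickB x))).
by rewrite -/(f x) fxy (xchooseP (pickB y)).
Qed.

Lemma star_minor_ltn (G : sgraph) t : minor (star t) G -> t < #|G|.
Proof. by move/minor_card; rewrite card_option card_ord. Qed.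

Lemma star_number_max (G : sgraph) t :
  minor (star t) G -> t <= star_number G.
Proof.
move=> m; pose i := Ordinal (star_minor_ltn m).
exact: (@leq_bigmax_cond _ _ (fun i : 'I_#|G| => i : nat) i m).
Qed.

Lemma star_minor0 (G : sgraph) : 0 < #|G| -> minor (star 0) G.
Proof.
case/card_gt0P=> a _; apply/existsP; exists [ffun=> [set a]].
have only x : x = None :> star 0 by case: x => [[]|].
apply/and3P; split; apply/forallP=> x.
- have sub u : u \in [set a] -> u = a by move/set1P.
  rewrite ffunE; apply/andP; split.
    by apply/card_gt0P; exists (exist _ a (set11 a)).
  apply/forallP=> u; apply/forallP=> v.
  suff -> : u = v by exact: connect0.
  by apply: val_inj; rewrite (sub _ (valP u)) (sub _ (valP v)).
- by apply/forallP=> y; rewrite (only x) (only y) eqxx.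
- by apply/forallP=> y; rewrite (only x) (only y).
Qed.

Lemma star_number_minor (G : sgraph) :
  0 < #|G| -> minor (star (star_number G)) G.
Proof.
move=> G_gt0.
have nonempty : 0 < #|[pred t : 'I_#|G| | minor (star t) G]|.
  by apply/card_gt0P; exists (Ordinal G_gt0); exact: star_minor0.
rewrite /star_number.
by have [t t_minor ->] := eq_bigmax_cond (fun t : 'I_#|G| => t : nat) nonempty.
Qed.

(* Main.v *)
(* Choose a vertex [u] whose removal leaves the tree connected, and a spanning
   tree of the rest rooted at a neighbour of [u].  Going up from the leaves,
   collect the vertices not yet used in a connected residual set containing the
   current root, and put this set aside whenever it reaches [n] vertices.  Two
   residual sets have fewer than [n] vertices each, so every merge wastes at
   most [n - 1] vertices.  Hence with [l] leaves, [k] sets put aside and a final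
   residual set [X], the rest has at most [#|X| + k * n + (l - 1) * (n - 1)]
   vertices.  Its [l] leaves and [u] are the leaves of a star minor, so
   [l + 1 <= s(T)], and the size hypothesis forces [n <= k]. *)
Require Import Defs.
From mathcomp Require Import all_boot all_order all_algebra.
From mathcomp Require Import zify.

Set Implicit Arguments.
Unset Strict Implicit.
Unset Printing Implicit Defensive.

(** * Connected vertex sets and induction on rooted ones *)

Section ConnectedSets.
Variable G : sgraph.
Implicit Types (A B C D L X Y Z : {set G}) (r c x y : G) (P Q : seq {set G}).

(* Connectivity by cuts: [A] is the only nonempty subset of [A] that no edge
   to a vertex of [A] leaves. *)
Definition set_connected A : bool :=
  (A != set0) &&
  [forall X : {set G}, [&& X \subset A, X != set0 &
     [forall x in X, forall y in A, edge x y ==> (y \in X)]] ==> (X == A)].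

Lemma set_connectedP A :
  reflect (A != set0 /\ forall X x, X \subset A -> x \in X ->
             (forall y z, y \in X -> z \in A -> edge y z -> z \in X) ->
             A \subset X)
          (set_connected A).
Proof.
apply: (iffP andP) => -[A0 H]; split=> //.
  move=> X x XA xX cl; have /eqP-> // : X == A.
  move/forallP/(_ X)/implyP: H; apply.
  rewrite XA /=; apply/andP; split; first by apply/set0Pn; exists x.
  apply/forall_inP=> y yX; apply/forall_inP=> z zA; apply/implyP.
  exact: cl.
apply/forallP=> X; apply/implyP=> /and3P[XA X0 cl].
have [x xX] := set0Pn _ X0.
rewrite eqEsubset XA /=; apply: (H X x XA xX) => y z yX zA.
by move/forall_inP/(_ y yX)/forall_inP/(_ z zA)/implyP: cl; apply.
Qed.

Lemma set_connected1 x : set_connected [set x].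
Proof.
apply/set_connectedP; split; first by apply/set0Pn; exists x; rewrite set11.
by move=> X y /subsetP XA yX _; rewrite sub1set -(set1P (XA _ yX)).
Qed.

(** A subset closed in the union swallows whichever of [A], [B] it meets, and the edge [x y] then
    carries it into the other. *)
Lemma set_connectedU A B x y :
  set_connected A -> set_connected B -> x \in A -> y \in B -> edge x y ->
  set_connected (A :|: B).
Proof.
move=> /set_connectedP[A0 HA] /set_connectedP[B0 HB] xA yB xy.
apply/set_connectedP; split.
  by apply/set0Pn; exists x; rewrite inE xA.
move=> X z /subsetP XAB zX cl.
have full D u : (forall X x, X \subset D -> x \in X ->
    (forall y z, y \in X -> z \in D -> edge y z -> z \in X) -> D \subset X) ->
    D \subset A :|: B -> u \in X -> u \in D -> D \subset X.
  move=> HD /subsetP DAB uX uD.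
  suff: D \subset X :&: D by rewrite subsetI => /andP[].
  apply: (HD _ u); rewrite ?subsetIr ?inE ?uX //.
  move=> v w /setIP[vX _] wD vw.
  by rewrite inE wD andbT (cl v) // DAB.
have AX u : u \in X -> u \in A -> A \subset X by apply: full; rewrite ?subsetUl.
have BX u : u \in X -> u \in B -> B \subset X by apply: full; rewrite ?subsetUr.
rewrite subUset; have [zA|zB] := setUP (XAB z zX).
  have sA := AX z zX zA; rewrite sA /= (BX y) //.
  by apply: (cl x) xy; rewrite ?(subsetP sA) // inE yB orbT.
have sB := BX z zX zB; rewrite sB andbT (AX x) //.
by apply: (cl y); rewrite 1?edge_sym // ?(subsetP sB) // inE xA.
Qed.

Lemma set_connectedU1 A x y :
  set_connected A -> y \in A -> edge x y -> set_connected (x |: A).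
Proof.
by move=> cA yA; apply: set_connectedU cA _ yA; rewrite ?set_connected1 ?set11.
Qed.

Lemma set_connected_cut A X x :
  set_connected A -> X \proper A -> x \in X ->
  exists y z, [/\ y \in X, z \in A :\: X & edge y z].
Proof.
move=> /set_connectedP[_ HA] /properP[XA [u uA uX]] xX.
case: (boolP [exists y in X, exists z in A :\: X, edge y z]).
  by case/exists_inP=> y yX /exists_inP[z zA yz]; exists y, z.
move=> no; case/negP: uX; apply: (subsetP (HA X x XA xX _)) => // y z yX zA yz.
apply: contraR no => zX; apply/exists_inP; exists y => //.
by apply/exists_inP; exists z; rewrite // inE zX.
Qed.

(** [B] is a maximal connected subset of [A] through [x]; a neighbour outside [B] could be added to
    it. *)
Lemma connected_component A x :
  x \in A ->
  exists B, [/\ set_connected B, B \subset A, x \in B &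
               forall y z, y \in B -> z \in A -> edge y z -> z \in B].
Proof.
move=> xA; have : set_connected [set x] && ([set x] \subset A).
  by rewrite set_connected1 sub1set.
case/(@maxset_exists _ (fun B => set_connected B && (B \subset A))) => B.
case/maxsetP=> /andP[cB BA] Bmax; rewrite sub1set => xB.
exists B; split=> // y z yB zA; rewrite edge_sym => zy.
rewrite -(Bmax (z |: B)) ?setU11 ?subsetUr //.
by rewrite (set_connectedU1 cB yB zy) subUset sub1set zA.
Qed.

(* A component [B] of the set without its root [r] is split off; the merging
   case applies as long as more than [r] remains. *)
Lemma rooted_connected_ind (Q : {set G} -> G -> Prop) :
  (forall r, Q [set r] r) ->
  (forall B r c, set_connected B -> c \in B -> r \notin B -> edge r c ->
     Q B c -> Q (r |: B) r) ->
  (forall A B r c, r \in A -> c \in B -> 1 < #|A| -> [disjoint A & B] ->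
     edge r c -> Q A r -> Q B c -> Q (A :|: B) r) ->
  forall A r, set_connected A -> r \in A -> Q A r.
Proof.
move=> Q1 Qext Qmerge A r.
have [m] := ubnP #|A|; elim: m A r => // m IHm A r leAm cA rA.
have [->|Ar] := eqVneq A [set r]; first exact: Q1.
have [_ [c [/set1P-> /setDP[cinA cr] rc]]] : exists y c,
    [/\ y \in [set r], c \in A :\: [set r] & edge y c].
  apply: (set_connected_cut cA _ (set11 r)).
  by rewrite properEneq eq_sym Ar sub1set.
have [|B [cB BA cinB Bcl]] := @connected_component (A :\ r) c.
  by rewrite inE cr.
have rB : r \notin B by apply: contraTN rA => /(subsetP BA); rewrite !inE eqxx.
have sBA : B \subset A by apply: subset_trans BA (subsetDl _ _).
have QB : Q B c.
  apply: IHm => //; apply: leq_trans (leAm : #|A| <= m).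
  by apply: proper_card; apply/properP; split=> //; exists r.
have EA : (A :\: B) :|: B = A by rewrite setUC -{1}(setIidPr sBA) setID.
have rD : r \in A :\: B by rewrite inE rB.
have [Dr|Dr] := eqVneq (A :\: B) [set r].
  by rewrite -EA Dr; apply: Qext rc QB.
have dDB : [disjoint A :\: B & B] by rewrite disjoints_subset setDE subsetIr.
(* The component [D] of [r] in [A :\: B] is all of it. Otherwise an edge of [A] leaves [D :|: B]:
   from [D] it contradicts the closure of [D], and from [B] it can only lead to [r], which lies in
   [D]. *)
have cD : set_connected (A :\: B).
  have [D [connD DAB rinD Dcl]] := connected_component rD.
  suff -> : A :\: B = D by [].
  apply/eqP; rewrite eqEsubset DAB andbT; apply: contraT => nDAB.
  have rDB : r \in D :|: B by rewrite inE rinD.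
  have [|y [z [yDB /setDP[zA zDB] yz]]] := set_connected_cut cA _ rDB.
    rewrite properE subUset sBA (subset_trans DAB (subsetDl _ _)) /=.
    by apply: contraNN nDAB; rewrite subDset setUC.
  have := zDB; rewrite in_setU => /norP[zD zB]; case/negP: zD.
  case/setUP: yDB => [yD|yB]; first by apply: Dcl yD _ yz; rewrite inE zB.
  case/negP: zB; apply: Bcl yB _ yz; rewrite !inE zA andbT.
  by apply: contraNneq zDB => ->.
rewrite -EA; apply: (Qmerge _ _ r c) => //.
  rewrite (cardsD1 r) rD ltnS card_gt0; apply: contraNneq Dr => /eqP.
  by rewrite setD_eq0 => sD; rewrite eqEsubset sD sub1set.
apply: IHm => //; apply: leq_trans (leAm : #|A| <= m).
apply: proper_card; apply/properP; split; first exact: subsetDl.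
by exists c; rewrite // inE cinB.
Qed.

(** * From connected sets to induced trees and star minors *)

Lemma set_connected_setT : connected_graph G -> set_connected [set: G].
Proof.
case/andP=> G_gt0 /forallP conn; apply/set_connectedP; split.
  by rewrite -card_gt0 cardsT.
move=> X x _ xX cl; apply/subsetP=> y _.
have symG : connect_sym (@edge G) by apply: sym_connect_sym; exact: edge_sym.
have /closed_connect Xcl : closed (@edge G) X.
  by apply: (intro_closed symG) => u v uv uX; apply: cl uX _ uv; rewrite inE.
by rewrite -(Xcl x) //; have /forallP := conn x.
Qed.

Lemma connected_graph_induced A :
  set_connected A -> connected_graph (induced A).
Proof.
case/set_connectedP=> /set0Pn[a aA] HA; apply/andP; split.
  by apply/card_gt0P; exists (exist _ a aA).
apply/forallP=> x; apply/forallP=> y.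
(* The vertices reachable from [x] inside [induced A], seen in [G], are closed under edges of [A],
   hence are all of [A]. *)
pose X := [set val u | u : induced A & connect (@edge (induced A)) x u].
have XA : X \subset A by apply/subsetP=> _ /imsetP[u _ ->]; exact: (valP u).
have xX : val x \in X by apply: imset_f; rewrite inE connect0.
have /subsetP/(_ _ (valP y)) : A \subset X.
  apply: (HA X _ XA xX) => _ z /imsetP[u xu ->] zA uz.
  apply/imsetP; exists (exist _ z zA : induced A) => //.
  move: xu; rewrite !inE => xu; apply: connect_trans xu (connect1 _).
  by rewrite /edge /= zA uz (valP u).
by case/imsetP=> u; rewrite inE => xu /val_inj->.
Qed.

Lemma is_tree_induced A :
  acyclic_graph G -> set_connected A -> is_tree (induced A).
Proof.
move=> acG cA; split; first exact: connected_graph_induced.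
move=> c /andP[cyc uc]; rewrite -(size_map val); apply: acG.
apply/andP; split; last by rewrite map_inj_uniq //; exact: val_inj.
rewrite cycle_map; apply: sub_cycle cyc => u v.
by case/and3P.
Qed.

Definition adjacent_to C L : Prop :=
  forall x, x \in L -> exists2 y, y \in C & edge y x.

(** The branch set of the centre is [C], those of the leaves are the singletons of [L]. *)
Lemma star_minor C L :
  set_connected C -> [disjoint C & L] -> adjacent_to C L ->
  minor (star #|L|) G.
Proof.
move=> cC dCL adj.
pose B (x : star #|L|) : {set G} :=
  if x is Some i then [set enum_val i] else C.
have dC i : [disjoint C & [set @enum_val _ (mem L) i]].
  by apply: disjointWr dCL; rewrite sub1set enum_valP.
have adjC i :
    [exists u in C, exists v in [set @enum_val _ (mem L) i], edge u v].
  have [u uC uv] := adj _ (enum_valP i).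
  apply/exists_inP; exists u => //.
  by apply/exists_inP; exists (enum_val i); rewrite ?set11.
apply/existsP; exists (finfun B); apply/and3P; split.
- apply/forallP=> x; rewrite ffunE; apply: connected_graph_induced.
  by case: x => [i|] //=; exact: set_connected1.
- apply/forallP=> x; apply/forallP=> y; apply/implyP; rewrite !ffunE.
  case: x y => [i|] [j|] //= nij.
    rewrite disjoints1 inE (inj_eq enum_val_inj).
    by apply: contraNneq nij => ->.
  by rewrite disjoint_sym.
apply/forallP=> x; apply/forallP=> y; apply/implyP; rewrite !ffunE.
case: x y => [i|] [j|] //= _.
have /exists_inP[u uC /exists_inP[v vi uv]] := adjC i.
apply/exists_inP; exists v => //; apply/exists_inP; exists u => //.
by rewrite edge_sym.
Qed.

(** * Leaves of rooted spanning trees *)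

Lemma disjoint_setUl A B C :
  [disjoint A :|: B & C] = [disjoint A & C] && [disjoint B & C].
Proof. by rewrite -!setI_eq0 setIUl setU_eq0. Qed.

(* [L] is the set of leaves and [C] that of the internal vertices of a
   spanning tree of [A] with root [r]; the root of a one-vertex tree counts
   as a leaf, and otherwise it is internal. *)
Definition rooted_star A r C L : Prop :=
  [/\ C :|: L \subset A, [disjoint C & L], L != set0 &
      A = [set r] /\ C = set0 \/
      [/\ r \in C, set_connected C & adjacent_to C L]].

(** Serves both inductive cases, with [D] either [[set r]] or the internal vertices on the side of
    [r]. If [B] is the single vertex [c], then [c] stays a leaf, now adjacent to [r]; otherwise the
    edge [r c] joins [D] to [C]. *)
Lemma rooted_star_hang B c C L D r :
  rooted_star B c C L -> set_connected D -> r \in D -> edge r c ->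
  set_connected (D :|: C) /\ adjacent_to (D :|: C) L.
Proof.
move=> [sB _ _ HC] cD rD rc; case: HC => [[EB EC]|[cinC cC adj]].
  rewrite EC setU0; split=> // x xL; exists r => //.
  have /set1P-> // : x \in [set c].
  by rewrite -EB (subsetP sB) // inE xL orbT.
split; first exact: set_connectedU cD cC rD cinC rc.
by move=> x /adj[y yC yx]; exists y; rewrite // inE yC orbT.
Qed.

Lemma rooted_star_ext B c C L r :
  rooted_star B c C L -> r \notin B -> edge r c ->
  rooted_star (r |: B) r (r |: C) L.
Proof.
move=> st rB rc; have [sB dCL L0 _] := st.
have [cC adj] := rooted_star_hang st (set_connected1 r) (set11 r) rc.
split=> //; first by rewrite -setUA setUS.
  rewrite disjoint_setUl dCL andbT disjoints1; apply: contraNN rB => rL.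
  by rewrite (subsetP sB) // inE rL orbT.
by right; split; rewrite ?setU11.
Qed.

Lemma disjointUU A B C D X Y :
  C :|: X \subset A -> D :|: Y \subset B -> [disjoint A & B] ->
  [disjoint C & X] -> [disjoint D & Y] -> [disjoint C :|: D & X :|: Y].
Proof.
rewrite !subUset => /andP[CA XA] /andP[DB YB] AB CX DY.
rewrite -setI_eq0 setIUl !setIUr !setU_eq0 !setI_eq0 CX DY andbT /=.
by rewrite (disjointW CA YB AB) disjoint_sym (disjointW XA DB AB).
Qed.

(** As [1 < #|A|], the root [r] is already internal, so no leaf is lost and the leaf sets add up. *)
Lemma rooted_star_merge A r CA LA B c CB LB :
  rooted_star A r CA LA -> rooted_star B c CB LB -> 1 < #|A| ->
  [disjoint A & B] -> edge r c ->
  rooted_star (A :|: B) r (CA :|: CB) (LA :|: LB).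
Proof.
move=> [sA dA LA0 [[-> _]|[rCA cCA adjA]]] stB; first by rewrite cards1.
move=> A2 dAB rc; have [sB dB _ _] := stB.
have [cC adjB] := rooted_star_hang stB cCA rCA rc.
split; first by rewrite setUACA setUSS.
- exact: disjointUU sA sB dAB dA dB.
- by apply: contraNneq LA0 => /eqP; rewrite setU_eq0 => /andP[].
right; split=> //; first by rewrite inE rCA.
move=> x /setUP[/adjA[y yC yx]|/adjB//].
by exists y; rewrite // inE yC.
Qed.

(** * Packings by large connected sets *)

(* [X] is the residual set, with no lower bound on its size. *)
Definition packing n A X P : Prop :=
  [/\ pairwise (fun Y Z : {set G} => [disjoint Y & Z]) (X :: P),
      forall Y, Y \in X :: P -> Y \subset A
    & forall Y, Y \in P -> set_connected Y /\ n <= #|Y|].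

Lemma packing_close n A X P :
  packing n A X P -> set_connected X -> n <= #|X| ->
  packing n A set0 (X :: P).
Proof.
move=> [dP sP cP] cX nX; split.
- rewrite pairwise_cons dP andbT; apply/allP=> Y _.
  by rewrite -setI_eq0 set0I.
- by move=> Y; rewrite inE => /predU1P[->|/sP//]; rewrite sub0set.
by move=> Y; rewrite inE => /predU1P[->|/cP].
Qed.

(** [Z] may be smaller than [X :|: Y], so that residual vertices can be discarded. *)
Lemma packing_cat n A X P B Y Q Z :
  packing n A X P -> packing n B Y Q -> [disjoint A & B] ->
  Z \subset X :|: Y -> packing n (A :|: B) Z (P ++ Q).
Proof.
move=> [dP sP cP] [dQ sQ cQ] dAB sZ.
move: dP dQ; rewrite !pairwise_cons => /andP[/allP dXP dP] /andP[/allP dYQ dQ].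
have sPA U : U \in P -> U \subset A by move=> UP; rewrite sP // inE UP orbT.
have sQB U : U \in Q -> U \subset B by move=> UQ; rewrite sQ // inE UQ orbT.
have sXA : X \subset A by rewrite sP ?mem_head.
have sYB : Y \subset B by rewrite sQ ?mem_head.
split.
- rewrite pairwise_cons pairwise_cat dP dQ !andbT; apply/andP; split.
    apply/allP=> U; rewrite mem_cat => UPQ; apply: disjointWl sZ _.
    rewrite disjoint_setUl; apply/andP; split.
      by case/orP: UPQ => [/dXP|/sQB sU] //; exact: disjointW sXA sU dAB.
    case/orP: UPQ => [/sPA sU|/dYQ//].
    by rewrite disjoint_sym; exact: disjointW sU sYB dAB.
  apply/allrelP=> U V /sPA sU /sQB sV; exact: disjointW sU sV dAB.
- move=> U; rewrite inE mem_cat => /predU1P[->|/orP[/sPA|/sQB] sU].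
  + exact: subset_trans sZ (setUSS sXA sYB).
  + exact: subset_trans sU (subsetUl _ _).
  + exact: subset_trans sU (subsetUr _ _).
by move=> U; rewrite mem_cat => /orP[/cP|/cQ].
Qed.

(** A nonempty residual set is connected and contains the root, so it can still grow across the edge
    from [r] to its parent. *)
Lemma rooted_packing n A r :
  1 < n -> set_connected A -> r \in A ->
  exists C L X P,
    [/\ rooted_star A r C L, packing n A X P, #|X| < n,
        X = set0 \/ r \in X /\ set_connected X
      & #|A| <= #|X| + size P * n + #|L|.-1 * n.-1].
Proof.
move=> n1; move: A r; apply: rooted_connected_ind.
- move=> r; exists set0, [set r], [set r], [::]; split.
  + split; [by rewrite set0U | by rewrite -setI_eq0 set0I | | by left].
    by rewrite -card_gt0 cards1.
  + by split=> // Y; rewrite inE => /eqP->.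
  + by rewrite cards1.
  + by right; rewrite set11 set_connected1.
  by rewrite !cards1.
- move=> B r c cB cinB rB rc [C [L [X [P [st pk ltX HX leB]]]]].
  have pk' : packing n (r |: B) (r |: X) P.
    apply: (@packing_cat _ _ [set r] [::] _ X); rewrite ?disjoints1 //.
    by split=> // Y; rewrite inE => /eqP->.
  have cX : set_connected (r |: X).
    case: HX => [->|[cX connX]]; first by rewrite setU0 set_connected1.
    exact: set_connectedU1 connX cX rc.
  have sXB : X \subset B by case: pk => _ -> //; rewrite mem_head.
  have EX : #|r |: X| = #|X|.+1.
    by rewrite cardsU1 (contraNN (subsetP sXB r) rB).
  have EB : #|r |: B| = #|B|.+1 by rewrite cardsU1 rB.
  have st' := rooted_star_ext st rB rc.
  have [lt_Xn|le_nX] := ltnP #|r |: X| n.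
    exists (r |: C), L, (r |: X), P; split=> //; first by right; rewrite setU11.
    by rewrite EX EB; clear -leB; lia.
  (* Since [#|X| < n], the set put aside has exactly [n] vertices and nothing is wasted. *)
  exists (r |: C), L, set0, ((r |: X) :: P); split; rewrite ?cards0 //.
  + exact: packing_close.
  + exact: ltnW.
  + by left.
  rewrite EB /=; clear -leB ltX; lia.
move=> A B r c rA cinB A2 dAB rc.
move=> [CA [LA [X [P [stA pkA ltX HX leA]]]]].
move=> [CB [LB [Y [Q [stB pkB ltY HY leB]]]]].
have st := rooted_star_merge stA stB A2 dAB rc.
have [sA _ LA0 _] := stA; have [sB _ LB0 _] := stB.
have EL : #|LA :|: LB| = #|LA| + #|LB|.
  rewrite cardsU disjoint_setI0 ?cards0 ?subn0 //.
  by apply: disjointW dAB; [move: sA | move: sB]; rewrite subUset => /andP[].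
have EAB : #|A :|: B| = #|A| + #|B|.
  by rewrite cardsU disjoint_setI0 ?cards0 ?subn0.
have sXA : X \subset A by case: pkA => _ -> //; rewrite mem_head.
have sYB : Y \subset B by case: pkB => _ -> //; rewrite mem_head.
have EXY : #|X :|: Y| = #|X| + #|Y|.
  by rewrite cardsU disjoint_setI0 ?cards0 ?subn0 //; apply: disjointW dAB.
have pk Z : Z \subset X :|: Y -> packing n (A :|: B) Z (P ++ Q).
  exact: packing_cat.
move: LA0 LB0; rewrite -!card_gt0 => a_gt0 b_gt0.
(* Both leaf sets are nonempty, so the truncated predecessors leave exactly one extra [n.-1] to pay
   for this merge. *)
have waste : #|LA :|: LB|.-1 * n.-1 =
    #|LA|.-1 * n.-1 + #|LB|.-1 * n.-1 + n.-1.
  rewrite EL -mulnDl -mulSnr; congr (_ * _); clear -a_gt0 b_gt0; lia.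
(* When [X] is empty, [r] is already used or discarded and cannot extend [Y]; the at most [n.-1]
   vertices of [Y] are thrown away at the cost of this merge. *)
case: HX => [X0|[rX cX]].
  exists (CA :|: CB), (LA :|: LB), set0, (P ++ Q); split; rewrite ?cards0 //.
  + by apply: pk; rewrite sub0set.
  + exact: ltnW.
  + by left.
  rewrite waste EAB size_cat; move: leA ltY leB; rewrite X0 cards0; clear; lia.
have cXY : set_connected (X :|: Y).
  case: HY => [->|[cinY cY]]; first by rewrite setU0.
  exact: set_connectedU cX cY rX cinY rc.
have [lt_n|le_n] := ltnP #|X :|: Y| n.
  exists (CA :|: CB), (LA :|: LB), (X :|: Y), (P ++ Q); split=> //.
  + exact: pk.
  + by right; rewrite inE rX.
  rewrite waste EAB EXY size_cat; clear -leA leB; lia.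
(* The at most [2 * n.-1] vertices of [X :|: Y] are covered by the [n] counted for the new set plus
   the [n.-1] of this merge. *)
exists (CA :|: CB), (LA :|: LB), set0, ((X :|: Y) :: P ++ Q).
split; rewrite ?cards0 //.
+ by apply: packing_close => //; exact: pk.
+ exact: ltnW.
+ by left.
rewrite waste EAB /= size_cat; clear -n1 ltX ltY leA leB; lia.
Qed.

(* A maximal connected proper subset misses exactly one vertex. *)
Lemma non_cut_vertex :
  connected_graph G -> 1 < #|G| ->
  exists u c, [/\ set_connected [set~ u], c != u & edge u c].
Proof.
move=> cG G1; have cT := set_connected_setT cG.
have /card_gt0P[x _] := ltnW G1.
have : set_connected [set x] && ([set x] \proper [set: G]).
  by rewrite set_connected1 properEcard subsetT cardsT cards1.
case/(@maxset_exists _ (fun B => set_connected B && (B \proper [set: G]))) => B.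
case/maxsetP=> /andP[cB BT] Bmax; rewrite sub1set => xB.
have [c [u [cinB /setDP[_ uB] cu]]] := set_connected_cut cT BT xB.
rewrite edge_sym in cu.
have EB : u |: B = [set: G].
  apply/eqP; rewrite -subTset; apply: contraNT uB => nT.
  rewrite -(Bmax (u |: B)) ?setU11 ?subsetUr //.
  by rewrite (set_connectedU1 cB cinB cu) properE subsetT.
exists u, c; split=> //; last first.
  by apply: contraTneq cu => ->; rewrite edge_irrefl.
suff <- : B = [set~ u] by [].
apply/setP=> y; rewrite !inE; have := in_setT y; rewrite -EB !inE.
by case: eqVneq => [->|] //= _; rewrite (negbTE uB).
Qed.
End ConnectedSets.

(** * The size bound and the conclusion *)

(** Adding [2 * (n - 1)] to both sides removes the possibly negative [s - 2], so the counting can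
    stay in [nat]. *)
Lemma nat_size_bound n s N :
  0 < n -> (n%:Z ^+ 2 + (s%:Z - 2) * (n%:Z - 1) + 1 <= N%:Z)%R ->
  n * n + s * n.-1 < N + 2 * n.-1.
Proof. by case: n => // n _ /=; lia. Qed.

Theorem mainTheorem11 (T : sgraph) (n : nat)
    (T_tree : is_tree T)
    (T_edge : exists x y : T, edge x y)
    (n_gt0 : 0 < n)
    (T_large :
      (n%:Z ^+ 2 + ((star_number T)%:Z - 2) * (n%:Z - 1) + 1 <= #|T|%:Z)%R) :
  exists S : 'I_n -> subgraph T,
    [/\ forall i, is_tree (S i),
        forall i j : 'I_n, i != j ->
          [disjoint sub_vertices (S i) & sub_vertices (S j)]
      & forall i, n <= #|sub_vertices (S i)|].
Proof.
have {}T_large := nat_size_bound n_gt0 T_large.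
have [cT acT] := T_tree.
(* For [n = 1] the whole tree serves. For larger [n] a single vertex is below the threshold, as
   [rooted_packing] requires. *)
have [n1|n2] := leqP n 1.
  have -> : n = 1 by lia.
  exists (fun=> induced [set: T]); split=> [i|i j|i].
  - exact: is_tree_induced acT (set_connected_setT cT).
  - by rewrite (ord1 i) (ord1 j) eqxx.
  by rewrite /= cardsT; case/andP: cT.
have T2 : 1 < #|T|.
  have [x [y xy]] := T_edge; rewrite (cardD1 x) (cardD1 y) !inE.
  by have -> : y != x by apply: contraTneq xy => ->; rewrite edge_irrefl.
have [u [c [cB cu uc]]] := non_cut_vertex cT T2.
have cinB : c \in [set~ u] by rewrite !inE.
have EB : #|T| = #|[set~ u]|.+1 by rewrite cardsC1 prednK // ltnW.
have [C [L [X [P [st pk ltX _ leB]]]]] := rooted_packing n2 cB cinB.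
have [sB dCL L0 star] := st.
have uL : u \notin L.
  have: u \notin [set~ u] by rewrite !inE negbK.
  by apply: contraNN => uL; apply: (subsetP sB); rewrite inE uL orbT.
have le_nP : n <= size P.
  (* In the first case [T] is the single edge [u c], and the size bound gives
     [n * n + s * n.-1 < 2 * n] with [s = star_number T], against [2 * n <= n * n]. *)
  case: star => [[EBc _]|[cC conC adj]].
    have s1 : 0 < star_number T.
      rewrite -(cards1 u); apply: star_number_max.
      apply: (star_minor (set_connected1 c)).
        by rewrite disjoints1 inE.
      by move=> x /set1P->; exists c; rewrite ?set11 // edge_sym.
    exfalso; move: T_large; rewrite EB EBc cards1.
    have: 1 * n.-1 <= star_number T * n.-1 by rewrite leq_mul.
    have: 2 * n <= n * n by rewrite leq_mul.
    clear -n2; lia.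
  (* Here [c] is internal, so its neighbour [u] is one more leaf around [C]. *)
  have sL : #|L| < star_number T.
    have <- : #|u |: L| = #|L|.+1 by rewrite cardsU1 uL.
    apply: star_number_max; apply: (star_minor conC).
      rewrite disjoint_sym disjoint_setUl disjoints1 disjoint_sym dCL andbT.
      have: u \notin [set~ u] by rewrite !inE negbK.
      by apply: contraNN => uC; apply: (subsetP sB); rewrite inE uC.
    move=> x /setU1P[->|/adj//]; exists c => //.
    by rewrite edge_sym.
  rewrite -card_gt0 in L0.
  (* With at most [n - 1] sets, [#|T|] is at most [1 + (n - 1) + (n - 1) * n + (s - 2) * (n - 1)],
     that is [n ^ 2 + (s - 2) * (n - 1)], one less than assumed. *)
  rewrite leqNgt; apply/negP => ltP.
  have leP : size P * n <= n.-1 * n by rewrite leq_mul //; clear -ltP; lia.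
  have leS : #|L|.-1.+2 * n.-1 <= star_number T * n.-1.
    by rewrite leq_mul //; clear -L0 sL; lia.
  clear -T_large EB leB ltX leP leS n2.
  by case: n n2 => // m _ in T_large leB ltX leP leS *; lia.
case: pk => dP _ cP; rewrite pairwise_cons in dP.
have {}dP := andP dP; case: dP => _ /(pairwiseP set0) dP.
(* The first [n] members of [P] are used; as [n <= size P], the default [set0] never occurs. *)
have inP (i : 'I_n) : nth set0 P i \in P.
  by rewrite mem_nth // (leq_trans (ltn_ord i)).
have ltP (i : 'I_n) : (i : nat) \in gtn (size P).
  by rewrite inE (leq_trans (ltn_ord i)).
exists (fun i : 'I_n => induced (nth set0 P i)); split=> [i|i j nij|i].
- by apply: is_tree_induced acT _; case: (cP _ (inP i)).
- rewrite /=; case: (ltngtP i j) => [ij|ji|/val_inj ij].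
  + exact: dP.
  + by rewrite disjoint_sym; exact: dP.
  by rewrite ij eqxx in nij.
by case: (cP _ (inP i)).
Qed.
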